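(* Let $\mathcal{H}$ be a Hilbert space and let $T\in\mathcal{L}(\mathcal{H},L^p(\mathbb{R}^d))$ for a suitable $p\in(2,\infty)$, with operator norm $\|T\|_{\mathcal{L}(\mathcal{H},L^p(\mathbb{R}^d))}$. Let $(h_n)_{n\in\mathbb{N}}$ be a sequence in $\mathcal{H}$ and let $\bar h\in\mathcal{H}$ be such that: (1) $\|h_n\|_{\mathcal{H}}=1$ for all $n$; (2) $\lim_{n\to\infty}\|T h_n\|_{L^p(\mathbb{R}^d)}=\|T\|_{\mathcal{L}(\mathcal{H},L^p(\mathbb{R}^d))}$; (3) $h_n\rightharpoonup\bar h$ weakly in $\mathcal{H}$ and $\bar h\neq 0$; (4) $T(h_n)\to T(\bar h)$ almost everywhere in $\mathbb{R}^d$. Then $h_n\to\bar h$ in $\mathcal{H}$ (in norm); in particular $\|\bar h\|_{\mathcal{H}}=1$ and $\|T(\bar h)\|_{L^p(\mathbb{R}^d)}=\|T\|_{\mathcal{L}(\mathcal{H},L^p(\mathbb{R}^d))}$.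
   Context: $\mathcal{L}(\mathcal{H},L^p(\mathbb{R}^d))$ denotes the space of linear and continuous operators from $\mathcal{H}$ to $L^p(\mathbb{R}^d)$, with the operator norm; $L^p(\mathbb{R}^d)$ is taken with respect to Lebesgue measure.
   Formalization: The operator T is additionally assumed to be nonzero; for T = 0 the claim fails, e.g. in ℓ² with h_n = (e_0 + e_{n+1})/√2 and h̄ = e_0/√2, where (1)–(4) hold but the norm of h̄ is 1/√2. *)

(* Defs.v *)
From HB Require Import structures.
From mathcomp Require Import all_boot all_order all_algebra.
From mathcomp Require Import all_classical all_reals all_analysis.
From mathcomp Require Import measurable_realfun complex.

Set Implicit Arguments.
Unset Strict Implicit.
Unset Printing Implicit Defensive.
Import Order.TTheory GRing.Theory Num.Theory.
Import numFieldNormedType.Exports.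

Local Open Scope classical_set_scope.
Local Open Scope ring_scope.

(* Hilbert spaces and L^p spaces are taken over the reals or the complexes. *)
Inductive scalars := Reals | Complexes.

Definition scalar_field (R : realType) (s : scalars) : numFieldType :=
  match s with Reals => R | Complexes => R[i] end.

Section scalar_ops.
Context {R : realType} {s : scalars}.

Definition sRe : scalar_field R s -> R :=
  match s return scalar_field R s -> R with
  | Reals => fun x => x
  | Complexes => fun z => complex.Re z
  end.

Definition sIm : scalar_field R s -> R :=
  match s return scalar_field R s -> R with
  | Reals => fun=> 0
  | Complexes => fun z => complex.Im z
  end.

Definition sreal : R -> scalar_field R s :=
  match s return R -> scalar_field R s with
  | Reals => fun x => x
  | Complexes => fun x => (x%:C)%C
  end.

Definition sconj : scalar_field R s -> scalar_field R s :=
  match s return scalar_field R s -> scalar_field R s with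
  | Reals => fun x => x
  | Complexes => fun z => conjc z
  end.

(* The library norm of a space over [scalar_field R s] is itself a scalar. *)
Definition rnorm {V : normedModType (scalar_field R s)} (x : V) : R := sRe `|x|.

Definition modulus (z : scalar_field R s) : R := sRe `|z|.

Definition opnorm {V W : normedModType (scalar_field R s)} (T : V -> W) : R :=
  sup [set rnorm (T x) | x in [set x : V | rnorm x <= 1]].

Definition weakly_cvg {V : normedModType (scalar_field R s)} (u : nat -> V) (l : V) :=
  forall phi : {linear V -> (scalar_field R s)^o}, continuous phi ->
    phi (u n) @[n --> \oo] --> phi l.

End scalar_ops.

Section scalar_theory.
Context {R : realType} {s : scalars}.
Implicit Types (z w : scalar_field R s) (r t : R).

Lemma modulus_ge0 z : 0 <= modulus z.
Proof.
rewrite /modulus; case: s z => [z|z]; first exact: (normr_ge0 (z : R)).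
have /= -> := congr1 (@complex.Re R) (normc_def z); exact: sqrtr_ge0.
Qed.

Lemma sreal_modulus z : sreal (modulus z) = `|z|.
Proof.
by rewrite /modulus; case: s z => [|] z.
Qed.

Lemma modulusE z : modulus z = Num.sqrt (sRe z ^+ 2 + sIm z ^+ 2).
Proof.
rewrite /modulus; case: s z => [z|z] /=.
  by rewrite expr0n/= addr0 sqrtr_sqr.
by have /= -> := congr1 (@complex.Re R) (normc_def z).
Qed.

Lemma sreal_le r t : (sreal r <= sreal t :> scalar_field R s) = (r <= t).
Proof. by case: s => //=; rewrite lecR. Qed.

Lemma sreal_inj : injective (sreal : R -> scalar_field R s).
Proof. by case: s => //= r t /complexI. Qed.

Lemma srealK : cancel (sreal : R -> scalar_field R s) sRe.
Proof. by case: s. Qed.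

Lemma sreal0 : sreal 0 = 0 :> scalar_field R s.
Proof. by case: s. Qed.

Lemma srealD r t : sreal (r + t) = sreal r + sreal t :> scalar_field R s.
Proof. by case: s => //=; rewrite rmorphD. Qed.

Lemma srealM r t : sreal (r * t) = sreal r * sreal t :> scalar_field R s.
Proof. by case: s => //=; rewrite rmorphM. Qed.

Lemma modulus0 : modulus (0 : scalar_field R s) = 0.
Proof. by apply: sreal_inj; rewrite sreal_modulus normr0 sreal0. Qed.

Lemma modulus_eq0 z : modulus z = 0 -> z = 0.
Proof. by move=> z0; apply/normr0_eq0; rewrite -sreal_modulus z0 sreal0. Qed.

Lemma modulusM z w : modulus (z * w) = modulus z * modulus w.
Proof. by apply: sreal_inj; rewrite srealM !sreal_modulus normrM. Qed.

Lemma modulusD z w : modulus (z + w) <= modulus z + modulus w.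
Proof. by rewrite -sreal_le srealD !sreal_modulus ler_normD. Qed.

Lemma sRe0 : sRe (0 : scalar_field R s) = 0. Proof. by case: s. Qed.
Lemma sIm0 : sIm (0 : scalar_field R s) = 0. Proof. by case: s. Qed.
Lemma sReD z w : sRe (z + w) = sRe z + sRe w.
Proof. by case: s z w => //= -[a b] [c d]. Qed.
Lemma sImD z w : sIm (z + w) = sIm z + sIm w.
Proof. by case: s z w => //= [z w|[a b] [c d]//]; rewrite addr0. Qed.
Lemma sReM z w : sRe (z * w) = sRe z * sRe w - sIm z * sIm w.
Proof. by case: s z w => //= [z w|[a b] [c d]//]; rewrite mulr0 subr0. Qed.
Lemma sImM z w : sIm (z * w) = sRe z * sIm w + sIm z * sRe w.
Proof. by case: s z w => //= [z w|[a b] [c d]//]; rewrite mulr0 mul0r addr0. Qed.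

End scalar_theory.

Section Lp_functions.
Context d (X : measurableType d) (R : realType) (s : scalars).
Variable mu : {measure set X -> \bar R}.
Variable p : R.
Local Notation K := (scalar_field R s).
Implicit Types f g : X -> K.

(* A scalar function is measurable when its real and imaginary parts are. *)
Definition smeasurable f :=
  measurable_fun setT (sRe \o f) /\ measurable_fun setT (sIm \o f).

Definition sLnorm f : \bar R := 'N[mu]_(p%:E)[EFin \o (modulus \o f)]%E.

Lemma smeasurable0 : smeasurable 0.
Proof.
split; rewrite [X in measurable_fun _ X](_ : _ = cst 0); try exact: measurable_cst.
  by apply/funext => x /=; rewrite sRe0.
by apply/funext => x /=; rewrite sIm0.
Qed.

Lemma smeasurableD f g : smeasurable f -> smeasurable g -> smeasurable (f + g).
Proof.
move=> [fr fi] [gr gi]; split.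
  rewrite (_ : _ \o _ = (sRe \o f) \+ (sRe \o g)); first exact: measurable_funD.
  by apply/funext => x /=; rewrite sReD.
rewrite (_ : _ \o _ = (sIm \o f) \+ (sIm \o g)); first exact: measurable_funD.
by apply/funext => x /=; rewrite sImD.
Qed.

Lemma smeasurableZ (a : K) f : smeasurable f -> smeasurable (a *: f).
Proof.
move=> [fr fi]; split.
  rewrite (_ : _ \o _ =
      (cst (sRe a) \* (sRe \o f)) \- (cst (sIm a) \* (sIm \o f))); last first.
    by apply/funext => x /=; rewrite -sReM.
  by apply: measurable_funB; exact: measurable_funM.
rewrite (_ : _ \o _ =
    (cst (sRe a) \* (sIm \o f)) \+ (cst (sIm a) \* (sRe \o f))); last first.
  by apply/funext => x /=; rewrite -sImM.
by apply: measurable_funD; exact: measurable_funM.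
Qed.

Lemma measurable_modulus f :
  smeasurable f -> measurable_fun setT (modulus \o f).
Proof.
move=> [mr mi].
rewrite (_ : _ \o _ = fun x => Num.sqrt (sRe (f x) ^+ 2 + sIm (f x) ^+ 2)).
  apply: (measurableT_comp (continuous_measurable_fun (@sqrt_continuous R))).
  by apply: measurable_funD; apply: measurable_funX.
by apply/funext => x /=; rewrite modulusE.
Qed.

Lemma le_Lnorm (f g : X -> R) : measurable_fun setT f -> measurable_fun setT g ->
  0 <= p -> (forall x, 0 <= f x <= g x) ->
  ('N[mu]_(p%:E)[EFin \o f] <= 'N[mu]_(p%:E)[EFin \o g])%E.
Proof.
move=> mf mg p0 fg; rewrite unlock /Lnorm.
have m (h : X -> R) : measurable_fun setT h ->
    measurable_fun setT (fun x : X => `|(EFin \o h) x| `^ p)%E.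
  move=> mh; apply: (measurableT_comp (measurable_poweR _)) => //.
  by apply: measurableT_comp => //; exact/measurable_EFinP.
apply: gt0_ler_poweR; rewrite ?invr_ge0 ?in_itv/= ?leey ?andbT//.
- by apply: integral_ge0 => x _; rewrite lee_fin powR_ge0.
- by apply: integral_ge0 => x _; rewrite lee_fin powR_ge0.
apply: ge0_le_integral => //; [exact: (m f)|exact: (m g)|].
move=> x _; have /andP[f0 fgx] := fg x.
by rewrite lee_fin ge0_ler_powR ?nnegrE// !ger0_norm// (le_trans f0).
Qed.

Hypothesis p1 : 1 <= p.

Let p0 : 0 <= p. Proof. exact: le_trans p1. Qed.

Lemma sLnorm0 : sLnorm 0 = 0%E.
Proof.
rewrite /sLnorm (_ : _ \o _ = cst 0%E).
  by apply: Lnorm0; rewrite eqe gt_eqF// (lt_le_trans _ p1).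
by apply/funext => x /=; rewrite modulus0.
Qed.

Lemma sLnormD f g : smeasurable f -> smeasurable g ->
  (sLnorm (f + g)%R <= sLnorm f + sLnorm g)%E.
Proof.
move=> mf mg; have mfg := smeasurableD mf mg.
move: mfg mf mg => /measurable_modulus mfg /measurable_modulus mf
  /measurable_modulus mg.
apply: le_trans; last exact: (minkowski_EFin _ mf mg p1).
apply: le_Lnorm => //; first exact: measurable_funD.
by move=> x /=; rewrite modulus_ge0 modulusD.
Qed.

Lemma sLnormZ (a : K) f : smeasurable f -> (sLnorm f < +oo)%E ->
  sLnorm (a *: f) = ((modulus a)%:E * sLnorm f)%E.
Proof.
move=> /measurable_modulus mf foo.
have p1E : (1 <= p%:E)%E by rewrite lee_fin.
have fL : (modulus \o f) \in Lfun mu p%:E.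
  by apply/andP; rewrite ?inE; split => //; rewrite inE.
have := LnormZ (Lfun_Sub p1E fL) (modulus a).
rewrite (ger0_norm (modulus_ge0 a)) => <-.
congr Lnorm; apply/funext => x /=.
by rewrite modulusM.
Qed.

End Lp_functions.

Section Lp_space.
Context d (X : measurableType d) (R : realType) (s : scalars).
Variable mu : {measure set X -> \bar R}.
Variables (p : R) (p1 : 1 <= p).
Local Notation K := (scalar_field R s).

(* [p1] is only recorded so that closure under addition can be inferred. *)
Definition Lp_pred of 1 <= p : {pred X -> K} :=
  fun f => `[< smeasurable f /\ (sLnorm mu p f < +oo)%E >].

Lemma Lp_pred_closed : submod_closed (Lp_pred p1).
Proof.
split; first by apply/asboolP; split; [exact: smeasurable0|rewrite sLnorm0].
move=> a f g /asboolP[mf foo] /asboolP[mg goo].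
have maf := smeasurableZ a mf.
apply/asboolP; split; first exact: smeasurableD.
rewrite (le_lt_trans (sLnormD mu p1 maf mg))// lte_add_pinfty//.
rewrite sLnormZ// lte_mul_pinfty// lee_fin; exact: modulus_ge0.
Qed.

HB.instance Definition _ :=
  GRing.isSubmodClosed.Build K (X -> K) (Lp_pred p1) Lp_pred_closed.

Record Lp_fun := LpFun { Lp_val :> X -> K ; _ : Lp_val \in Lp_pred p1 }.

HB.instance Definition _ := [isSub for Lp_val].
HB.instance Definition _ := [Choice of Lp_fun by <:].
HB.instance Definition _ := [SubChoice_isSubLmodule of Lp_fun by <:].

Definition ae_null : {pred Lp_fun} :=
  fun f => `[< {ae mu, forall x, f x = 0} >].

Lemma ae_null_closed : zmod_closed ae_null.
Proof.
split; first by apply/asboolP; apply: nearW.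
move=> f g /asboolP f0 /asboolP g0; apply/asboolP.
by apply: filterS2 f0 g0 => x /= f0 g0; rewrite -[LHS]/(f x - g x) f0 g0 subr0.
Qed.

HB.instance Definition _ :=
  GRing.isZmodClosed.Build Lp_fun ae_null ae_null_closed.

(* Functions with finite p-norm modulo almost everywhere equality. *)
Definition Lp := Quotient.quot ae_null.

HB.instance Definition _ := GRing.Zmodule.on Lp.
HB.instance Definition _ := EqQuotient.on Lp.

Local Open Scope quotient_scope.

Definition Lp_class (f : Lp_fun) : Lp := \pi_Lp f.

Definition Lp_repr (u : Lp) : Lp_fun := repr u.

Lemma Lp_reprK u : Lp_class (Lp_repr u) = u.
Proof. exact: reprK. Qed.

Lemma Lp_classP f g :
  Lp_class f = Lp_class g <-> {ae mu, forall x, f x = g x}.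
Proof.
have -> : {ae mu, forall x, f x = g x} = (f - g \in ae_null) :> Prop.
  apply/propext; split=> [fg|/asboolP fg]; first apply/asboolP.
    by apply: filterS fg => x fgx; rewrite -[LHS]/(f x - g x) fgx subrr.
  by apply: filterS fg => x; rewrite -[X in X = _]/(f x - g x) => /subr0_eq.
by rewrite Quotient.idealrBE; split=> [/eqP|/eqP].
Qed.

Lemma Lp_class0 : Lp_class 0 = 0.
Proof. by rewrite /Lp_class piE. Qed.

Lemma Lp_classD f g : Lp_class (f + g) = Lp_class f + Lp_class g.
Proof. by rewrite /Lp_class piE. Qed.

Lemma Lp_repr_class f : {ae mu, forall x, Lp_repr (Lp_class f) x = f x}.
Proof. by apply/Lp_classP; rewrite Lp_reprK. Qed.

Definition Lp_scale (a : K) (u : Lp) : Lp := Lp_class (a *: Lp_repr u).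

Lemma Lp_scale_class a f : Lp_scale a (Lp_class f) = Lp_class (a *: f).
Proof.
apply/Lp_classP; apply: filterS (Lp_repr_class f) => x e.
by rewrite -[LHS]/(a * Lp_repr (Lp_class f) x) e.
Qed.

Lemma Lp_scaleA a b u : Lp_scale a (Lp_scale b u) = Lp_scale (a * b) u.
Proof. by rewrite Lp_scale_class scalerA. Qed.

Lemma Lp_scale1 : left_id 1 Lp_scale.
Proof. by move=> u; rewrite /Lp_scale scale1r Lp_reprK. Qed.

Lemma Lp_scaleDr : right_distributive Lp_scale +%R.
Proof.
move=> a u v; rewrite -[u]Lp_reprK -[v]Lp_reprK -Lp_classD.
by rewrite !Lp_scale_class scalerDr Lp_classD.
Qed.

Lemma Lp_scaleDl u : {morph Lp_scale^~ u : a b / a + b}.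
Proof. by move=> a b; rewrite /Lp_scale scalerDl Lp_classD. Qed.

HB.instance Definition _ := GRing.Zmodule_isLmodule.Build K Lp
  Lp_scaleA Lp_scale1 Lp_scaleDr Lp_scaleDl.

Lemma Lp_classZ a f : Lp_class (a *: f) = a *: Lp_class f.
Proof. by rewrite -[RHS]/(Lp_scale _ _) Lp_scale_class. Qed.

Lemma Lp_funP (f : Lp_fun) : smeasurable f /\ (sLnorm mu p f < +oo)%E.
Proof. by case: f => f /= /asboolP. Qed.

Lemma ae_eq_sLnorm (f g : Lp_fun) : {ae mu, forall x, f x = g x} ->
  sLnorm mu p f = sLnorm mu p g.
Proof.
have [mf _] := Lp_funP f; have [mg _] := Lp_funP g.
move=> fg; rewrite /sLnorm unlock /Lnorm; congr (_ `^ _)%E.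
have m (h : X -> K) : smeasurable h ->
    measurable_fun setT (fun x => `|(EFin \o (modulus \o h)) x| `^ p)%E.
  move=> /measurable_modulus mh; apply: (measurableT_comp (measurable_poweR _)) => //.
  by apply: measurableT_comp => //; exact/measurable_EFinP.
apply: ae_eq_integral => //; [exact: m|exact: m|].
by apply: filterS fg => x /= ->.
Qed.

Definition Lp_norm (u : Lp) : K := sreal (fine (sLnorm mu p (Lp_repr u))).

Lemma sLnorm_fin_num (f : Lp_fun) : sLnorm mu p f \is a fin_num.
Proof. by rewrite ge0_fin_numE ?Lnorm_ge0//; have [] := Lp_funP f. Qed.

Lemma Lp_norm_class f : Lp_norm (Lp_class f) = sreal (fine (sLnorm mu p f)).
Proof. by rewrite /Lp_norm (ae_eq_sLnorm (Lp_repr_class f)). Qed.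

Lemma Lp_normD u v : Lp_norm (u + v) <= Lp_norm u + Lp_norm v.
Proof.
rewrite -[u]Lp_reprK -[v]Lp_reprK -Lp_classD !Lp_norm_class -srealD sreal_le.
set f := Lp_repr u; set g := Lp_repr v.
rewrite -lee_fin EFinD !fineK ?sLnorm_fin_num//.
have [mf _] := Lp_funP f; have [mg _] := Lp_funP g.
exact: sLnormD.
Qed.

Lemma Lp_normZ a u : Lp_norm (a *: u) = `|a| * Lp_norm u.
Proof.
rewrite -[u]Lp_reprK -Lp_classZ !Lp_norm_class -sreal_modulus -srealM.
set f := Lp_repr u; have [mf foo] := Lp_funP f.
rewrite -[RHS]/(sreal (fine (modulus a)%:E * _)) -fineM ?sLnorm_fin_num//.
by rewrite -sLnormZ.
Qed.

Lemma Lp_norm0_eq0 u : Lp_norm u = 0 -> u = 0.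
Proof.
rewrite -[u]Lp_reprK -Lp_class0 Lp_norm_class.
set f := Lp_repr u; have [mf foo] := Lp_funP f.
rewrite -sreal0 => /sreal_inj f0; apply/Lp_classP.
have {}f0 : sLnorm mu p f = 0%E by rewrite -(fineK (sLnorm_fin_num f)) f0.
have mEf : measurable_fun setT (EFin \o (modulus \o f)).
  exact/measurable_EFinP/measurable_modulus.
have p_gt0 : (0 < p%:E)%E by rewrite lte_fin (lt_le_trans _ p1).
by apply: filterS (Lnorm_eq0_eq0 mEf p_gt0 f0) => x /(_ I)/= [/modulus_eq0].
Qed.

HB.instance Definition _ := Lmodule_isNormed.Build K Lp
  Lp_normD Lp_normZ Lp_norm0_eq0.

Lemma rnorm_Lp (u : Lp) : rnorm u = fine (sLnorm mu p (Lp_repr u)).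
Proof. by rewrite -[LHS]/(sRe (Lp_norm u)) /Lp_norm srealK. Qed.

End Lp_space.

(* Lebesgue measure on R^n (n-tuples with the product sigma-algebra), obtained
   as the n-fold product of the one-dimensional measure; see [lebesgue_Rn_box]. *)
Section lebesgue_Rn.
Context (R : realType).
Local Notation Rn n := (n.-tuple (measurableTypeR R)).

Definition cons_pair n (x : measurableTypeR R * Rn n) : Rn n.+1 :=
  [tuple of x.1 :: x.2].

Definition uncons_pair n (t : Rn n.+1) : measurableTypeR R * Rn n :=
  (thead t, [tuple of behead t]).

Lemma measurable_cons_pair n : measurable_fun setT (@cons_pair n).
Proof. by apply: measurable_cons. Qed.

Lemma measurable_uncons_pair n : measurable_fun setT (@uncons_pair n).
Proof.
apply: measurable_fun_pair; first exact: measurable_tnth.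
exact: measurable_behead.
Qed.

Lemma cons_pairK n : cancel (@cons_pair n) (@uncons_pair n).
Proof.
move=> [x t]; congr pair.
exact: val_inj.
Qed.

Section step.
Variables (n : nat) (m : {sigma_finite_measure set (Rn n) -> \bar R}).

Definition lebesgue_Rn_step : set (Rn n.+1) -> \bar R :=
  pushforward (@lebesgue_measure R \x m)%E (@cons_pair n).

HB.instance Definition _ := Measure.copy lebesgue_Rn_step
  (measure_function_pushforward__canonical__measure_function_Measure
     (@lebesgue_measure R \x m)%E (@measurable_cons_pair n)).

Lemma lebesgue_Rn_step_sigma_finite : sigma_finite setT lebesgue_Rn_step.
Proof.
have /sigma_finiteP[F [TF ndF Foo]] := sigma_finiteT (@lebesgue_measure R).
have /sigma_finiteP[G [TG ndG Goo]] := sigma_finiteT m.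
exists (fun k => @uncons_pair n @^-1` (F k `*` G k)) => [|k].
  apply/esym; rewrite -preimage_bigcup -subTset => t _.
  have [i _ Fi] : (\bigcup_i F i) (uncons_pair t).1 by rewrite -TF.
  have [j _ Gj] : (\bigcup_i G i) (uncons_pair t).2 by rewrite -TG.
  exists (maxn i j) => //; split.
  - by move: Fi; exact/subsetPset/ndF/leq_maxl.
  - by move: Gj; exact/subsetPset/ndG/leq_maxr.
have [? ?] := Foo k; have [? ?] := Goo k.
have mFG : measurable (F k `*` G k) by exact: measurableX.
split.
  by rewrite -[X in measurable X]setTI; exact: measurable_uncons_pair.
rewrite /lebesgue_Rn_step /pushforward -comp_preimage.
rewrite (_ : _ \o _ = id); last by apply/funext => x /=; rewrite cons_pairK.
by rewrite preimage_id product_measure1E// lte_mul_pinfty// ge0_fin_numE.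
Qed.

HB.instance Definition _ := Measure_isSigmaFinite.Build _ _ _
  lebesgue_Rn_step lebesgue_Rn_step_sigma_finite.

End step.

Fixpoint lebesgue_Rn n : {sigma_finite_measure set (Rn n) -> \bar R} :=
  match n with
  | 0 => \d_([tuple])
  | n'.+1 => lebesgue_Rn_step (lebesgue_Rn n')
  end.

Lemma lebesgue_Rn_box n (A : 'I_n -> set (measurableTypeR R)) :
  (forall i, measurable (A i)) ->
  lebesgue_Rn n [set t | forall i, A i (tnth t i)] =
  (\prod_(i < n) lebesgue_measure (A i))%E.
Proof.
elim: n A => [|n IH] A mA.
  rewrite big_ord0 /= diracE mem_set// => -[]//.
rewrite big_ord_recl -IH; last by move=> i; exact: mA.
rewrite /= /lebesgue_Rn_step /pushforward -product_measure1E//; last first.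
  rewrite (_ : [set _ | _] =
      \bigcap_(i in [set: 'I_n])
        ((@tnth _ (measurableTypeR R) ^~ i) @^-1` A (lift ord0 i))).
    apply: fin_bigcap_measurable; first exact: finite_finset.
    move=> i _; rewrite -[X in measurable X]setTI; exact: measurable_tnth.
  by apply/seteqP; split=> t /= h i; [move=> _|]; exact: h.
congr (_ _); apply/seteqP; split=> -[x t] /=.
  move=> h; split=> [|i]; first exact: (h ord0).
  by have := h (lift ord0 i); rewrite tnthS.
move=> [h0 h] i; case: (unliftP ord0 i) => [j|] ->.
  by rewrite tnthS.
by rewrite tnth0.
Qed.

End lebesgue_Rn.
Arguments lebesgue_Rn R n : clear implicits.

Lemma gt2_ge1 (R : realType) (p : R) : 2 < p -> 1 <= p.
Proof. by move=> /ltW; apply: le_trans; rewrite ler1n. Qed.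

(* Main.v *)
Require Import Defs.
From HB Require Import structures.
From mathcomp Require Import all_boot all_order all_algebra.
From mathcomp Require Import all_classical all_reals all_analysis.
From mathcomp Require Import measurable_realfun complex.
From mathcomp Require Import lra.

Set Implicit Arguments.
Unset Strict Implicit.
Unset Printing Implicit Defensive.
Import Order.TTheory GRing.Theory Num.Theory.
Import numFieldNormedType.Exports.

Local Open Scope classical_set_scope.
Local Open Scope ring_scope.

(** Why the theorem holds: a maximizing sequence cannot lose mass to infinity,
    because the mass that stays in the weak limit and the mass that escapes are
    added with exponent 2 in H but with exponent p > 2 in L^p.

    Put A = opnorm T > 0 and a = |hbar|^2 in ]0, 1]. Weak convergence makes
    the cross term of |h_n|^2 = |h_n - hbar|^2 + |hbar|^2 + 2 Re <h_n - hbar,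
    hbar> vanish, so |h_n - hbar|^2 tends to 1 - a ([weakly_cvg_rnorm]). In
    L^p, almost everywhere convergence gives the upper half of the Brezis-Lieb
    identity, lim |T h_n|^p <= |T hbar|^p + (lim D_n)^p for any convergent
    bounds D_n of |T h_n - T hbar| ([Lp_brezis_lieb_le]). With
    D_n = A |h_n - hbar| and |T hbar| <= A |hbar| it yields

      A^p <= A^p a^(p/2) + A^p (1 - a)^(p/2).

    As p/2 > 1 and a > 0, this forces a = 1 ([powR_add_onem_ge1]). Then
    |h_n - hbar| tends to 0, and the remaining claims follow by continuity.

    The Brezis-Lieb inequality comes from Fatou's lemma applied to
    k |T h_n - T hbar|^p + c |T hbar|^p - |T h_n|^p, which is nonnegative by
    convexity of x |-> x^p when k = (1 - t)^(1 - p) and c = t^(1 - p)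
    ([powR_add_le]); letting t tend to 0 sends k to 1.

    Real and complex scalars are treated together by working throughout with
    the real-valued norm [rnorm] instead of the scalar-valued norm. *)

(** * Real-valued norms *)

Section rnorm_theory.
Context {R : realType} {s : scalars}.
Local Notation K := (scalar_field R s).

Lemma sreal_sRe (z : K) : 0 <= z -> sreal (sRe z) = z.
Proof.
case: s z => //= -[a b]; rewrite lecE/= => /andP[/eqP -> _].
by [].
Qed.

Lemma sRe_sconj (z : K) : sRe (sconj z) = sRe z.
Proof. by case: s z => //= -[]. Qed.

Lemma normr_sRe_le (z : K) : `|sRe z| <= modulus z.
Proof.
by rewrite modulusE -sqrtr_sqr ler_sqrt ?lerDl ?sqr_ge0// addr_ge0 ?sqr_ge0.
Qed.

Lemma sRe_sqr_sreal (r : R) : sRe (sreal r ^+ 2 : K) = r ^+ 2.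
Proof. by rewrite !expr2 -srealM srealK. Qed.

Lemma sreal_lt (r t : R) : (sreal r < sreal t :> K) = (r < t).
Proof. by rewrite !lt_neqAle sreal_le (inj_eq sreal_inj). Qed.

Context {V : normedModType K}.
Implicit Types (x y : V) (c : K).

Lemma sreal_rnorm x : sreal (rnorm x) = `|x|.
Proof. exact: sreal_sRe. Qed.

Lemma rnorm_ge0 x : 0 <= rnorm x.
Proof. by rewrite -(sreal_le (s := s)) sreal_rnorm sreal0. Qed.

Lemma rnorm_eq0 x : (rnorm x == 0) = (x == 0).
Proof.
rewrite -(normr_eq0 x) -sreal_rnorm -sreal0.
by apply/eqP/eqP => [->//|/sreal_inj].
Qed.

Lemma rnorm0 : rnorm (0 : V) = 0.
Proof. by apply/eqP; rewrite rnorm_eq0. Qed.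

Lemma rnormZ c x : rnorm (c *: x) = modulus c * rnorm x.
Proof.
apply: (sreal_inj (s := s)).
by rewrite srealM !sreal_rnorm sreal_modulus normrZ.
Qed.

Lemma rnormD x y : rnorm (x + y) <= rnorm x + rnorm y.
Proof. by rewrite -(sreal_le (s := s)) srealD !sreal_rnorm ler_normD. Qed.

Lemma rnormBC x y : rnorm (x - y) = rnorm (y - x).
Proof. by rewrite /rnorm distrC. Qed.

Lemma ler_dist_rnorm x y : `|rnorm x - rnorm y| <= rnorm (x - y).
Proof.
have := rnormD (x - y) y; have := rnormD (y - x) x.
rewrite !subrK (rnormBC y x) -!lerBlDr -[rnorm y - _]opprB => yx xy.
by rewrite ler_norml xy lerNl yx.
Qed.

(** The topology of [V] is defined with scalar radii; this is the passage to
    limits of real sequences, where all later estimates live. *)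
Lemma cvg_rnormP (u : nat -> V) (l : V) :
  u n @[n --> \oo] --> l <-> rnorm (u n - l) @[n --> \oo] --> (0 : R).
Proof.
split=> [/cvgrPdist_lt ul|/cvgr0Pnorm_lt ul].
- apply/cvgr0Pnorm_lt => e; rewrite -sreal_lt sreal0 => /ul.
  apply: filterS => n.
  by rewrite distrC -sreal_rnorm sreal_lt ger0_norm ?rnorm_ge0.
- apply/cvgrPdist_lt => e e0.
  have /ul : 0 < sRe e by rewrite -sreal_lt sreal0 sreal_sRe ?ltW.
  apply: filterS => n; rewrite ger0_norm ?rnorm_ge0// => une.
  by rewrite distrC -sreal_rnorm -[ltRHS](sreal_sRe (ltW e0)) sreal_lt.
Qed.

Lemma cvg_rnorm (u : nat -> V) (l : V) :
  u n @[n --> \oo] --> l -> rnorm (u n) @[n --> \oo] --> rnorm l.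
Proof.
move=> /cvg_rnormP ul; apply/cvgrPdist_lt => e e0.
move/cvgr0Pnorm_lt : ul => /(_ _ e0); apply: filterS => n.
rewrite ger0_norm ?rnorm_ge0//; apply: le_lt_trans.
by rewrite distrC ler_dist_rnorm.
Qed.

End rnorm_theory.

(** * Operator norm *)

Section opnorm_theory.
Context {R : realType} {s : scalars}.
Local Notation K := (scalar_field R s).
Context {V W : normedModType K} (T : {linear V -> W}).
Hypothesis Tcont : continuous T.

Lemma continuous_linear_rnorm_bounded :
  exists2 M : R, 0 <= M & forall x, rnorm (T x) <= M * rnorm x.
Proof.
have /linear_boundedP/pinfty_ex_gt0[M M0 TM] : bounded_near T (nbhs 0).
  by apply/linear_bounded_continuous.
have ME := sreal_sRe (ltW M0).
exists (sRe M) => [|x]; first by rewrite -(sreal_le (s := s)) sreal0 ME ltW.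
by rewrite -(sreal_le (s := s)) srealM ME !sreal_rnorm; exact: TM.
Qed.

(** Without an upper bound, the supremum defining [opnorm] would be a default
    value and say nothing on [T]. *)
Lemma has_sup_opnorm : has_sup [set rnorm (T x) | x in [set x | rnorm x <= 1]].
Proof.
have [M M0 TM] := continuous_linear_rnorm_bounded.
split; first by exists (rnorm (T 0)); exists 0 => //=; rewrite rnorm0.
exists M => _ [x /= x1 <-]; apply: le_trans (TM x) _.
by rewrite ler_piMr.
Qed.

Lemma le_opnorm x : rnorm (T x) <= opnorm T * rnorm x.
Proof.
have [->|x0] := eqVneq x 0; first by rewrite linear0 !rnorm0 mulr0.
have nx0 : 0 < rnorm x by rewrite lt_neqAle rnorm_ge0 eq_sym rnorm_eq0 x0.
have mc : modulus (sreal (rnorm x)^-1 : K) = (rnorm x)^-1.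
  apply: (sreal_inj (s := s)); rewrite sreal_modulus ger0_norm//.
  by rewrite -sreal0 sreal_le invr_ge0 ltW.
rewrite -ler_pdivrMr// mulrC -mc -rnormZ -linearZ.
apply: sup_upper_bound; first exact: has_sup_opnorm.
by eexists; [|reflexivity]; rewrite /= rnormZ mc mulVf ?gt_eqF.
Qed.

Lemma opnorm_gt0 : (exists x, T x != 0) -> 0 < opnorm T.
Proof.
move=> [x Tx0]; have nTx : 0 < rnorm (T x).
  by rewrite lt_neqAle rnorm_ge0 eq_sym rnorm_eq0 Tx0.
have := lt_le_trans nTx (le_opnorm x).
rewrite pmulr_lgt0// lt_neqAle rnorm_ge0 eq_sym rnorm_eq0.
by case: (eqVneq x 0) Tx0 => [->|//]; rewrite linear0 eqxx.
Qed.

End opnorm_theory.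

(** * Inner product and weak convergence *)

Section inner_product.
Context {R : realType} {s : scalars} {H : normedModType (scalar_field R s)}.
Local Notation K := (scalar_field R s).
Variable ip : {dot H for sconj}.
Hypothesis ipE : forall x : H, `|x| ^+ 2 = ip x x.

Lemma ip_conj x y : ip x y = sconj (ip y x).
Proof. by rewrite hermitian_subproof expr0 mul1r. Qed.

Lemma ipDl x y z : ip (x + y) z = ip x z + ip y z.
Proof. exact: linearDl. Qed.

Lemma ipDr x y z : ip x (y + z) = ip x y + ip x z.
Proof. exact: linearDr. Qed.

Lemma ipBl x y z : ip (x - y) z = ip x z - ip y z.
Proof. exact: linearBl. Qed.

Lemma ipZl a x y : ip (a *: x) y = a * ip x y.
Proof. exact: linearZl_LR. Qed.

Lemma ipZr a x y : ip x (a *: y) = sconj a * ip x y.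
Proof. exact: linearZr_LR. Qed.

Lemma sqr_rnorm x : rnorm x ^+ 2 = sRe (ip x x).
Proof. by rewrite -ipE -sreal_rnorm sRe_sqr_sreal. Qed.

Lemma sqr_rnormD x y :
  rnorm (x + y) ^+ 2 = rnorm x ^+ 2 + rnorm y ^+ 2 + sRe (ip x y) *+ 2.
Proof.
rewrite !sqr_rnorm ipDl !ipDr !sReD [ip y x]ip_conj sRe_sconj.
by rewrite -addrA [_ + (_ + sRe (ip y y))]addrA -mulr2n addrA addrAC.
Qed.

(** Pythagoras applied to the decomposition of [x] into its projection on the
    line of [y] and the orthogonal remainder [w]. *)
Lemma cauchy_schwarz x y : modulus (ip x y) <= rnorm x * rnorm y.
Proof.
have [->|y0] := eqVneq y 0; first by rewrite linear0r modulus0 rnorm0 mulr0.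
have ny0 : 0 < rnorm y by rewrite lt_neqAle rnorm_ge0 eq_sym rnorm_eq0 y0.
have ipy0 : ip y y != 0 by rewrite gt_eqF// neq0_dnorm_gt0.
pose c : K := ip x y / ip y y; pose w := x - c *: y.
have wy : ip w y = 0.
  by rewrite ipBl ipZl divfK ?subrr.
have wcy : ip w (c *: y) = 0 by rewrite ipZr wy mulr0.
have mipy : modulus (ip y y) = rnorm y ^+ 2.
  by apply: (sreal_inj (s := s)); rewrite sreal_modulus -ipE normrX normr_id
    -sreal_rnorm !expr2 srealM.
have : rnorm (c *: y) <= rnorm x.
  rewrite -ler_sqr ?nnegrE ?rnorm_ge0// -[in leRHS](subrK (c *: y) x) -/w.
  by rewrite sqr_rnormD wcy sRe0 mul0rn addr0 lerDr sqr_ge0.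
rewrite rnormZ; have -> : modulus c * rnorm y = modulus (ip x y) / rnorm y.
  have e : modulus c * rnorm y ^+ 2 = modulus (ip x y).
    by rewrite -mipy -modulusM divfK.
  by rewrite -e expr2 mulrA mulfK ?gt_eqF.
by rewrite ler_pdivrMr.
Qed.

(** The Cauchy-Schwarz inequality makes [ip ^~ y] a continuous functional, hence
    an admissible test for weak convergence. *)
Lemma weakly_cvg_ip (h : nat -> H) (l y : H) : weakly_cvg h l ->
  sRe (ip (h n - l) y) @[n --> \oo] --> (0 : R).
Proof.
move=> hl; pose phi0 : H -> K^o := fun x => ip x y.
have lin : linear phi0.
  by move=> a u v; rewrite /phi0 ipDl ipZl.
pose phi : {linear H -> K^o} :=
  HB.pack phi0 (GRing.isLinear.Build _ _ _ _ phi0 lin).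
have phic : continuous phi.
  apply/linear_bounded_continuous/linear_boundedP.
  exists `|y|; split=> [|r yr x]; first exact: normr_real.
  rewrite mulrC; apply: (@le_trans _ _ (`|x| * `|y|)).
    rewrite -(sreal_rnorm x) -(sreal_rnorm y) -srealM.
    rewrite -[leLHS](sreal_modulus (ip x y)) sreal_le.
    exact: cauchy_schwarz.
  by rewrite ler_wpM2l// ltW.
have /cvg_rnormP := hl phi phic.
move=> /cvgr0Pnorm_lt phih; apply/cvgr0Pnorm_lt => e /phih.
apply: filterS => n; rewrite ger0_norm ?rnorm_ge0//; apply: le_lt_trans.
by apply: le_trans (normr_sRe_le _) _; rewrite ipBl.
Qed.

(** Squared norms split asymptotically between the weak limit and the remainder:
    the cross term is twice the real part of [ip (h n - l) l], which vanishes by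
    weak convergence tested against [l] itself. *)
Lemma weakly_cvg_rnorm (h : nat -> H) (l : H) :
  (forall n, rnorm (h n) = 1) -> weakly_cvg h l ->
  rnorm (h n - l) ^+ 2 @[n --> \oo] --> 1 - rnorm l ^+ 2.
Proof.
move=> h1 hl.
have -> : (fun n => rnorm (h n - l) ^+ 2) =
    (fun n => 1 - rnorm l ^+ 2 - sRe (ip (h n - l) l) *+ 2).
  apply/funext => n.
  have E : 1 = rnorm (h n - l) ^+ 2 + rnorm l ^+ 2 + sRe (ip (h n - l) l) *+ 2.
    by rewrite -sqr_rnormD subrK h1 expr1n.
  by rewrite [in RHS]E addrAC addrK addrK.
rewrite -[X in _ --> X]subr0; apply: cvgB; first exact: cvg_cst.
rewrite -(mul0rn _ 2); apply: cvgMn.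
exact: weakly_cvg_ip.
Qed.

End inner_product.

(** * Real powers *)

Section powR_facts.
Context {R : realType}.
Implicit Types (a p q t x y : R).

Lemma cvg_powR p (u : nat -> R) l : 0 < p -> (forall n, 0 <= u n) ->
  u n @[n --> \oo] --> l -> u n `^ p @[n --> \oo] --> l `^ p.
Proof.
move=> p0 u0 ul.
have l0 : 0 <= l.
  by apply: (cvgr_to_ge ul); exact: nearW.
(* At 0 the power is not differentiable in general: argue with epsilons. *)
move: l0; rewrite le_eqVlt => /predU1P[l0|l0].
  rewrite -l0 powR0 ?gt_eqF//; apply/cvgr0Pnorm_lt => e e0.
  have ep0 : 0 < e `^ p^-1 by rewrite powR_gt0.
  rewrite -l0 in ul; move/cvgr0Pnorm_lt : ul => /(_ _ ep0); apply: filterS => n.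
  rewrite !ger0_norm ?powR_ge0// => une.
  have -> : e = (e `^ p^-1) `^ p by rewrite -powRrM mulVf ?gt_eqF// powRr1 ?ltW.
  by apply: gt0_ltr_powR; rewrite ?nnegrE// ltW.
have cl : {for l, continuous (fun x : R => x `^ p)}.
  apply: differentiable_continuous; apply/derivable1_diffP/derivable_powR.
  by rewrite in_itv/= l0.
exact: (cvg_comp _ _ ul cl).
Qed.

(** Convexity of [z |-> z `^ p] at [x + y], seen as the barycentre of
    [x / (1 - t)] and [y / t] with weights [1 - t] and [t]. For small [t] the
    coefficient of [x `^ p] is close to 1, at the price of a large coefficient
    for [y `^ p]. *)
Lemma powR_add_le p t x y : 1 <= p -> 0 < t -> t < 1 -> 0 <= x -> 0 <= y ->
  (x + y) `^ p <= (1 - t) `^ (1 - p) * x `^ p + t `^ (1 - p) * y `^ p.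
Proof.
move=> p1 t0 t1 x0 y0.
have t1' : 0 < 1 - t by rewrite subr_gt0.
have homog a z : 0 < a -> 0 <= z -> a `^ (1 - p) * z `^ p = a * (z / a) `^ p.
  move=> a0 z0; have a0' := ltW a0.
  rewrite powRM ?invr_ge0// -(powR_inv1 a0') -powRrM mulN1r.
  rewrite powRD ?powRr1 ?(gt_eqF a0) ?implybT//.
  by rewrite -mulrA [X in _ * X]mulrC.
rewrite !homog//.
have cvx : (t * (y / t) + (1 - t) * (x / (1 - t))) `^ p <=
    t * (y / t) `^ p + (1 - t) * (x / (1 - t)) `^ p.
  apply: (convex_powR p1 (Itv01 (ltW t0) (ltW t1)));
    by rewrite inE/= in_itv/= andbT divr_ge0// ltW.
move: cvx; rewrite [t * (y / t)]mulrC [(1 - t) * (x / (1 - t))]mulrC.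
by rewrite !divfK ?gt_eqF// [y + x]addrC [X in _ <= X -> _]addrC.
Qed.

(** For [q > 1] the power lies strictly below the identity on the open unit
    interval, so two nontrivial parts of a unit mass have [q]-th powers adding
    up to less than 1. *)
Lemma powR_add_onem_ge1 q a : 1 < q -> 0 < a -> a <= 1 ->
  1 <= a `^ q + (1 - a) `^ q -> a = 1.
Proof.
move=> q1 a0; rewrite le_eqVlt => /predU1P[//|a1].
have b0 : 0 < 1 - a by rewrite subr_gt0.
have b1 : 1 - a < 1 by rewrite ltrBlDr ltrDl.
have lt c : 0 < c -> c < 1 -> c `^ q < c.
  move=> c0 c1; rewrite -(@mulr_powRB1 _ c) ?(ltW c0) ?(lt_trans _ q1)//.
  rewrite gtr_pMr//; have e : (1 : R) `^ (q - 1) = 1 by rewrite powR1.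
  by rewrite -[ltRHS]e; apply: gt0_ltr_powR; rewrite ?subr_gt0 ?nnegrE// ltW.
rewrite leNgt => /negP[].
by rewrite -[ltRHS](subrKC a) ltrD ?lt.
Qed.

End powR_facts.

(** * Fatou's lemma along an almost everywhere limit *)

Section fatou.
Context d (X : measurableType d) (R : realType).
Variable mu : {measure set X -> \bar R}.

(** The bounds [I n] stand in for the integrals of the [f n], which need not
    converge. *)
Lemma fatou_ae_cvg (f : nat -> X -> R) (g : X -> R) (I : nat -> R) (J : R) :
  (forall n, measurable_fun setT (f n)) -> (forall n x, 0 <= f n x) ->
  measurable_fun setT g -> (forall x, 0 <= g x) ->
  {ae mu, forall x, f n x @[n --> \oo] --> g x} ->
  (forall n, \int[mu]_x (f n x)%:E <= (I n)%:E)%E ->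
  I n @[n --> \oo] --> J ->
  (\int[mu]_x (g x)%:E <= J%:E)%E.
Proof.
move=> mf f0 mg g0 fg fI IJ.
pose F n x := (f n x)%:E.
have mF n : measurable_fun setT (F n) by exact/measurable_EFinP.
have F0 n x : setT x -> (0 <= F n x)%E by rewrite lee_fin.
have mlim : measurable_fun setT (fun x => limn_einf (F ^~ x)).
  rewrite (_ : (fun _ => _) = fun x => - limn_esup ((fun n => \- F n) ^~ x))%E.
    apply: measurableT_comp => //; apply: measurable_fun_limn_esup => n.
    exact: measurableT_comp.
  by apply/funext => x; rewrite limn_esupN oppeK.
have -> : (\int[mu]_x (g x)%:E = \int[mu]_x limn_einf (F ^~ x))%E.
  apply: ge0_ae_eq_integral => //.
  - exact/measurable_EFinP.
  - by move=> x _; rewrite lee_fin.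
  - move=> x _; rewrite limn_einf_lim.
    apply: lime_ge; first exact: is_cvg_einfs.
    by apply: nearW => n; apply: le_ereal_inf_tmp => _ [m /= _ <-]; exact: F0.
  - apply: filterS fg => x fgx _; apply/esym.
    have : F n x @[n --> \oo] --> (g x)%:E.
      by apply: cvg_EFin => //; exact: nearW.
    by move=> /cvg_limn_einf_sup[].
apply: (le_trans (fatou mu measurableT mF F0)).
have <- : limn_einf (EFin \o I) = J%:E.
  have IJ' : (EFin \o I) n @[n --> \oo] --> J%:E.
    by apply: cvg_EFin => //; exact: nearW.
  by have [] := cvg_limn_einf_sup IJ'.
rewrite !limn_einf_lim.
apply: lee_lim; [exact: is_cvg_einfs|exact: is_cvg_einfs|].
apply: nearW => n; apply: le_ereal_inf_tmp => _ [m /= nm <-].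
by apply: le_trans (fI m); apply: ereal_inf_lbound; exists m.
Qed.

End fatou.

(** * The Brezis-Lieb inequality in L^p *)

Section Lp_lemmas.
Context d (X : measurableType d) (R : realType) (s : scalars).
Variables (mu : {measure set X -> \bar R}) (p : R) (p1 : 1 <= p).
Local Notation K := (scalar_field R s).
Local Notation LpX := (Lp s mu p1).
Local Notation Lp_funX := (Lp_fun s mu p1).

Let p_gt0 : 0 < p. Proof. exact: lt_le_trans p1. Qed.

Lemma Lp_classB (f g : Lp_funX) :
  Lp_class (f - g) = Lp_class f - Lp_class g :> LpX.
Proof. by apply: (canRL (addrK _)); rewrite -Lp_classD subrK. Qed.

Lemma measurable_modulus_powR (f : Lp_funX) :
  measurable_fun setT (fun x => modulus (f x) `^ p).
Proof.
have [mf _] := Lp_funP f.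
apply: (measurableT_comp (measurable_powR _)) => //.
exact: measurable_modulus.
Qed.

Lemma rnorm_class_powR (f : Lp_funX) :
  (\int[mu]_x (modulus (f x) `^ p)%:E = (rnorm (Lp_class f) `^ p)%:E)%E.
Proof.
rewrite -poweR_EFin -[rnorm _]/(sRe (Lp_norm (Lp_class f))) Lp_norm_class.
rewrite srealK fineK ?sLnorm_fin_num// poweR_Lnorm ?gt_eqF//.
apply: eq_integral => x _ /=.
by rewrite ger0_norm ?modulus_ge0.
Qed.

(** The p-th powers of the norms of [u n] exceed that of their almost everywhere
    limit [v] asymptotically by no more than that of the remainder [u n - v].
    Fatou's lemma gives this with the factor [(1 - t) `^ (1 - p)] in front of
    [m `^ p], for each [t] in ]0, 1[; then [t] tends to 0. The remainder enters
    through bounds [D n], as only these are known to converge in the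
    application. *)
Lemma Lp_brezis_lieb_le (u : nat -> LpX) (v : LpX) (D : nat -> R) (l m : R) :
  {ae mu, forall x, Lp_repr (u n) x @[n --> \oo] --> Lp_repr v x} ->
  rnorm (u n) @[n --> \oo] --> l ->
  (forall n, rnorm (u n - v) <= D n) -> D n @[n --> \oo] --> m ->
  l `^ p <= rnorm v `^ p + m `^ p.
Proof.
move=> uv ul uD Dm.
have D0 n : 0 <= D n by apply: le_trans (uD n); exact: rnorm_ge0.
have key t : 0 < t -> t < 1 ->
    l `^ p <= rnorm v `^ p + (1 - t) `^ (1 - p) * m `^ p.
  move=> t0 t1; set k := (1 - t) `^ (1 - p); pose c := t `^ (1 - p).
  have k0 : 0 <= k by exact: powR_ge0.
  have c0 : 0 <= c by exact: powR_ge0.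
  have c1 : 1 <= c.
    rewrite -[leLHS](powRr0 t); apply: ger_powR; last by rewrite subr_le0.
    by rewrite t0 ltW.
  pose a n x := modulus (Lp_repr (u n) x) `^ p.
  pose b x := modulus (Lp_repr v x) `^ p.
  pose e n x := modulus ((Lp_repr (u n) - Lp_repr v : Lp_funX) x) `^ p.
  (* Pointwise limit of [F]: [(c - 1) * b], because [e] vanishes there. *)
  pose F n x := k * e n x + c * b x - a n x.
  have ma n : measurable_fun setT (a n) by exact: measurable_modulus_powR.
  have mb : measurable_fun setT b by exact: measurable_modulus_powR.
  have me n : measurable_fun setT (e n) by exact: measurable_modulus_powR.
  have mG n : measurable_fun setT (fun x => k * e n x + c * b x).
    by apply: measurable_funD; apply: measurable_funM.
  have mF n : measurable_fun setT (F n) by exact: measurable_funB.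
  have a0 n x : 0 <= a n x by exact: powR_ge0.
  have b0 x : 0 <= b x by exact: powR_ge0.
  have e0 n x : 0 <= e n x by exact: powR_ge0.
  have F0 n x : 0 <= F n x.
    rewrite subr_ge0; apply: le_trans (powR_add_le p1 t0 t1 _ _); last 2 first.
      exact: modulus_ge0.
      exact: modulus_ge0.
    apply: ge0_ler_powR; rewrite ?nnegrE ?addr_ge0 ?modulus_ge0 ?(ltW p_gt0)//.
    apply: le_trans (modulusD _ _).
    by rewrite -[X in modulus (X + _)]/(Lp_repr (u n) x - Lp_repr v x) subrK.
  have ia n : (\int[mu]_x (a n x)%:E = (rnorm (u n) `^ p)%:E)%E.
    by rewrite rnorm_class_powR Lp_reprK.
  have ib : (\int[mu]_x (b x)%:E = (rnorm v `^ p)%:E)%E.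
    by rewrite rnorm_class_powR Lp_reprK.
  have ie n : (\int[mu]_x (e n x)%:E = (rnorm (u n - v) `^ p)%:E)%E.
    by rewrite rnorm_class_powR Lp_classB !Lp_reprK.
  have iF n : (\int[mu]_x (F n x)%:E =
      (k * rnorm (u n - v) `^ p + c * rnorm v `^ p - rnorm (u n) `^ p)%:E)%E.
    have : (\int[mu]_x (F n x)%:E + \int[mu]_x (a n x)%:E =
            k%:E * \int[mu]_x (e n x)%:E + c%:E * \int[mu]_x (b x)%:E)%E.
      rewrite -ge0_integralD//; last 4 first.
      - by move=> x _; rewrite lee_fin.
      - exact/measurable_EFinP.
      - by move=> x _; rewrite lee_fin.
      - exact/measurable_EFinP.
      rewrite -!ge0_integralZl//; last 4 first.
      - exact/measurable_EFinP.
      - by move=> x _; rewrite lee_fin.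
      - exact/measurable_EFinP.
      - by move=> x _; rewrite lee_fin.
      rewrite -ge0_integralD//; last 4 first.
      - by move=> x _; rewrite lee_fin mulr_ge0.
      - by apply/measurable_EFinP; exact: measurable_funM.
      - by move=> x _; rewrite lee_fin mulr_ge0.
      - by apply/measurable_EFinP; exact: measurable_funM.
      by apply: eq_integral => x _; rewrite -EFinD subrK.
    rewrite ia ib ie => iFa; rewrite !EFinB EFinD !EFinM -iFa.
    by rewrite addeK.
  have : (\int[mu]_x ((c - 1) * b x)%:E <=
      (k * m `^ p + c * rnorm v `^ p - l `^ p)%:E)%E.
    apply: (@fatou_ae_cvg _ _ _ mu F _
      (fun n => k * D n `^ p + c * rnorm v `^ p - rnorm (u n) `^ p)) => //.
    - exact: measurable_funM.
    - by move=> x; rewrite mulr_ge0// subr_ge0.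
    - apply: filterS uv => x uvx.
      have -> : (c - 1) * b x = k * 0 `^ p + c * b x - b x.
        by rewrite powR0 ?gt_eqF// mulr0 add0r mulrBl mul1r.
      have modK :
          modulus (Lp_repr (u n) x - Lp_repr v x) @[n --> \oo] --> (0 : R).
        exact/(cvg_rnormP (V := K)).
      apply: cvgB; first apply: cvgD; last 2 first.
      + exact: cvg_cst.
      + apply: cvg_powR => // [n|]; first exact: modulus_ge0.
        exact: (cvg_rnorm (V := K)).
      apply: cvgM; first exact: cvg_cst.
      by apply: cvg_powR => // n; exact: modulus_ge0.
    - move=> n; rewrite iF lee_fin lerB// lerD// ler_wpM2l//.
      by apply: ge0_ler_powR; rewrite ?nnegrE ?rnorm_ge0 ?(ltW p_gt0).
    - apply: cvgB; first apply: cvgD; last 2 first.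
      + exact: cvg_cst.
      + by apply: cvg_powR => // n; exact: rnorm_ge0.
      apply: cvgM; first exact: cvg_cst.
      exact: cvg_powR.
  under eq_integral do rewrite EFinM.
  rewrite ge0_integralZl//; last 3 first.
  - exact/measurable_EFinP.
  - by move=> x _; rewrite lee_fin.
  - by rewrite lee_fin subr_ge0.
  rewrite ib -EFinM lee_fin; lra.
(* [1 - p] may be 0, so the limit t -> 0 is taken in the larger factor
   [(1 - t) `^ (- p) = (1 - t)^-1 `^ p], whose exponent [p] is positive. *)
pose r n : R := (1 - n.+2%:R^-1)^-1.
have r1 : r n @[n --> \oo] --> (1 : R).
  rewrite -[X in _ --> X]invr1; apply: cvgV; first exact: oner_neq0.
  rewrite -[X in _ --> X]subr0; apply: cvgB; first exact: cvg_cst.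
  by rewrite (cvg_shiftS (@harmonic R)); exact: cvg_harmonic.
have : rnorm v `^ p + r n `^ p * m `^ p @[n --> \oo] -->
    rnorm v `^ p + 1 `^ p * m `^ p.
  apply: cvgD; first exact: cvg_cst.
  apply: cvgM; last exact: cvg_cst.
  apply: cvg_powR => // n.
  by rewrite invr_ge0 subr_ge0 invf_le1 ?ler1n.
rewrite powR1 mul1r => /cvgr_to_ge; apply; apply: nearW => n.
have t0 : 0 < n.+2%:R^-1 :> R by rewrite invr_gt0.
have t1 : n.+2%:R^-1 < 1 :> R by rewrite invf_lt1// ltr1n.
apply: le_trans (key _ t0 t1) _; rewrite lerD2l ler_wpM2r ?powR_ge0//.
rewrite /r -[(1 - _)^-1]powR_inv1 ?subr_ge0 ?(ltW t1)// -powRrM mulN1r.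
by apply: ger_powR; rewrite ?lerDr// subr_gt0 t1 gerBl ltW.
Qed.

End Lp_lemmas.

(** * Compactness of the maximizing sequence *)

Theorem proposition0p1 (R : realType) (s : scalars)
    (H : completeNormedModType (scalar_field R s))
    (ip : {dot H for sconj}) (ipE : forall x : H, `|x| ^+ 2 = ip x x)
    (d : nat) (p : R) (p2 : 2 < p)
    (T : {linear H -> Lp s (lebesgue_Rn R d) (gt2_ge1 p2)})
    (Tcont : continuous T) (Tneq0 : exists x : H, T x != 0)
    (h : nat -> H) (hbar : H)
    (h_norm : forall n, rnorm (h n) = 1)
    (Th_norm : rnorm (T (h n)) @[n --> \oo] --> opnorm T)
    (h_weak : weakly_cvg h hbar) (hbar_neq0 : hbar != 0)
    (Th_ae : {ae lebesgue_Rn R d, forall x,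
      Lp_repr (T (h n)) x @[n --> \oo] --> Lp_repr (T hbar) x}) :
  [/\ h n @[n --> \oo] --> hbar,
      rnorm hbar = 1 &
      rnorm (T hbar) = opnorm T].
Proof.
have p0 : 0 < p by exact: (lt_trans _ p2).
have q1 : 1 < p / 2 by rewrite ltr_pdivlMr// mul1r.
have A0 : 0 < opnorm T by exact: opnorm_gt0.
set a := rnorm hbar ^+ 2.
have a0 : 0 < a.
  by rewrite exprn_gt0// lt_neqAle rnorm_ge0 eq_sym rnorm_eq0 hbar_neq0.
have h_dist2 : rnorm (h n - hbar) ^+ 2 @[n --> \oo] --> 1 - a.
  exact: (weakly_cvg_rnorm ipE h_norm h_weak).
have a1 : a <= 1.
  rewrite -subr_ge0; apply: (cvgr_to_ge h_dist2).
  by apply: nearW => n; exact: sqr_ge0.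
have h_dist : rnorm (h n - hbar) @[n --> \oo] --> Num.sqrt (1 - a).
  have -> : (fun n => rnorm (h n - hbar)) =
      (fun n => Num.sqrt (rnorm (h n - hbar) ^+ 2)).
    by apply/funext => n; rewrite sqrtr_sqr ger0_norm ?rnorm_ge0.
  exact: (cvg_comp _ _ h_dist2 (@sqrt_continuous R _)).
have sqrt_powR (x : R) : 0 <= x -> Num.sqrt x `^ p = x `^ (p / 2).
  by move=> x0; rewrite -powR12_sqrt// -powRrM mulrC.
have split_mass : 1 <= a `^ (p / 2) + (1 - a) `^ (p / 2).
  have BL : opnorm T `^ p <=
      rnorm (T hbar) `^ p + (opnorm T * Num.sqrt (1 - a)) `^ p.
    apply: (Lp_brezis_lieb_le (D := fun n => opnorm T * rnorm (h n - hbar))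
      Th_ae Th_norm).
      by move=> n; rewrite -linearB; exact: le_opnorm.
    by apply: cvgM => //; exact: cvg_cst.
  have Th : rnorm (T hbar) `^ p <= opnorm T `^ p * a `^ (p / 2).
    rewrite -sqrt_powR ?(ltW a0)// -powRM ?sqrtr_ge0 ?(ltW A0)//.
    rewrite sqrtr_sqr ger0_norm ?rnorm_ge0//.
    apply: ge0_ler_powR; last exact: le_opnorm.
    - exact: ltW.
    - by rewrite nnegrE rnorm_ge0.
    - by rewrite nnegrE mulr_ge0 ?rnorm_ge0 ?ltW.
  have Ap0 : 0 < opnorm T `^ p by exact: powR_gt0.
  rewrite -(ler_pM2l Ap0) mulr1 mulrDr (le_trans BL)// lerD//.
  by rewrite powRM ?sqrtr_ge0 ?(ltW A0)// sqrt_powR ?subr_ge0.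
have aE : a = 1 by exact: powR_add_onem_ge1 split_mass.
have h_cvg : h n @[n --> \oo] --> hbar.
  by apply/cvg_rnormP; rewrite aE subrr sqrtr0 in h_dist.
split=> //.
  by apply/eqP; rewrite -(@eqrXn2 _ 2) ?rnorm_ge0// expr1n; apply/eqP.
have Th_lim := cvg_rnorm (cvg_comp _ _ h_cvg (Tcont hbar)).
exact: (cvg_unique (@Rhausdorff R) Th_lim Th_norm).
Qed.
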